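(* Let $(W,S)$ be a Coxeter system (with $W$ finite or infinite). Let $w,u,v\in W$ and $s\in S$ be such that $w=uv$ and $R(ws)=R(w)$. Then there exists a unique factorization $ws=u'v'$ (that is, a unique pair $(u',v')\in W\times W$ with $ws=u'v'$) such that either (1) $u=u'$, $v^{-1}v'\in S$ and $R(v)=R(v')$; or (2) $v=v'$, $u^{-1}u'\in S$ and $R(u)=R(u')$.
   Context: $(W,S)$ is a Coxeter system with set of simple reflections $S$, and $\ell$ is the length function on $W$ with respect to $S$. For $w\in W$, the recoil set of $w$ is $R(w)=\{s\in S:\ell(sw)=\ell(w)-1\}$. *)

(* Defs.v *)
From HB Require Import structures.
From mathcomp Require Import all_boot.
From mathcomp Require Import mathcomp_extra boolp classical_sets.

Set Implicit Arguments.
Unset Strict Implicit.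
Unset Printing Implicit Defensive.

Local Open Scope classical_set_scope.
Local Open Scope group_scope.

Definition generates (W : groupType) (S : set W) : Prop :=
  forall H : {pred W},
    group_closed H -> (forall s, S s -> s \in H) -> forall w, w \in H.

(* The entry 0 encodes infinity.  Only the values of m on S x S matter. *)
Definition coxeter_matrix (W : groupType) (S : set W) (m : W -> W -> nat) :
    Prop :=
  [/\ forall s, S s -> m s s = 1%N,
      forall s t, S s -> S t -> m s t = m t s &
      forall s t, S s -> S t -> s <> t -> m s t <> 1%N].

(* (f s * f t) ^+ m s t = 1 for all s, t in S; there is no condition when
   m s t encodes infinity, as x ^+ 0 = 1. *)
Definition coxeter_relations (W G : groupType) (S : set W) (m : W -> W -> nat)
    (f : W -> G) : Prop :=
  forall s t, S s -> S t -> (f s * f t) ^+ m s t = 1.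

(* W = < S | (s t)^(m s t) = 1 >, expressed by the universal property of the
   presentation; uniqueness of phi follows from generation. *)
Definition coxeter_presentation (W : groupType) (S : set W)
    (m : W -> W -> nat) : Prop :=
  [/\ generates S,
      coxeter_relations S m (fun w : W => w) &
      forall (G : groupType) (f : W -> G), coxeter_relations S m f ->
        exists phi : W -> G,
          monoid_morphism phi /\ (forall s, S s -> phi s = f s)].

Definition coxeter_system (W : groupType) (S : set W) : Prop :=
  exists m : W -> W -> nat, coxeter_matrix S m /\ coxeter_presentation S m.

Definition has_word (W : groupType) (S : set W) (w : W) (n : nat) : Prop :=
  exists l : seq W,
    [/\ size l = n, (forall s, s \in l -> S s) & w = \prod_(s <- l) s].

(* The default value 0 is never used in a Coxeter system: S generates W and
   consists of involutions, so every w is a product of elements of S. *)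
Definition cox_length (W : groupType) (S : set W) (w : W) : nat :=
  xget 0%N [set n | has_word S w n /\
                    forall k, has_word S w k -> (n <= k)%N].

(* l(s w) = l(w) - 1 is written without truncated subtraction. *)
Definition recoil (W : groupType) (S : set W) (w : W) : set W :=
  [set s | S s /\ (cox_length S (s * w)).+1 = cox_length S w].

(* Main.v *)
(** Let N(w) be the set of reflections t with l(t w) < l(w).  It is built here
    without reference to lengths, as the cocycle N(x y) = N(x) + x N(y) x^-1
    (symmetric difference) with N(s) = {s}: the assignment s |-> (s, {s})
    satisfies the Coxeter relations in the semidirect product of W with the
    group of subsets of W.  The exchange condition gives R(w) = S `&` N(w).
    As N(w s) and N(w) differ exactly by w s w^-1, R(w s) = R(w) if and only if
    w s w^-1 is not simple.  Hence (1) means v' = v s with t := v s v^-1 not in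
    S, while (2) means u' = u t with t in S and u t u^-1 = w s w^-1 not in S;
    the last condition is the hypothesis, so exactly one of (1), (2) holds. *)
Require Import Defs.
From HB Require Import structures.
From mathcomp Require Import all_boot.
From mathcomp Require Import mathcomp_extra boolp classical_sets.

Set Implicit Arguments.
Unset Strict Implicit.
Unset Printing Implicit Defensive.

Local Open Scope classical_set_scope.
Local Open Scope group_scope.

(** * The semidirect product of W with the group of its subsets *)

Definition subset_sdprod (W : groupType) : Type := (W * (W -> bool))%type.

HB.instance Definition _ (W : groupType) :=
  Choice.copy (subset_sdprod W) (W * (W -> bool))%type.

(** Subsets are indicator functions and [(+)] is symmetric difference; as [x ^ g.1] is g.1^-1 x g.1,
    the second summand indicates the conjugate of [h.2] by g.1^-1 on the right, g.1 B g.1^-1. *)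
Definition sdmul (W : groupType) (g h : subset_sdprod W) : subset_sdprod W :=
  (g.1 * h.1, fun x => g.2 x (+) h.2 (x ^ g.1)).
Definition sdone (W : groupType) : subset_sdprod W := (1, fun=> false).
Definition sdinv (W : groupType) (g : subset_sdprod W) : subset_sdprod W :=
  (g.1^-1, fun x => g.2 (x ^ g.1^-1)).

Lemma sdmulA (W : groupType) : associative (@sdmul W).
Proof.
move=> [x A] [y B] [z C]; rewrite /sdmul /=.
congr pair; first exact: mulgA.
by apply/funext => t; rewrite addbA conjgM.
Qed.

Lemma sdmul1g (W : groupType) : left_id (sdone W) (@sdmul W).
Proof.
move=> [x A]; rewrite /sdmul /= mul1g.
by congr pair; apply/funext => t; rewrite conjg1.
Qed.

Lemma sdmulg1 (W : groupType) : right_id (sdone W) (@sdmul W).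
Proof.
move=> [x A]; rewrite /sdmul /= mulg1.
by congr pair; apply/funext => t; rewrite addbF.
Qed.

Lemma sdmulVg (W : groupType) : left_inverse (sdone W) (@sdinv W) (@sdmul W).
Proof.
move=> [x A]; rewrite /sdmul /= mulVg.
by congr pair; apply/funext => t; rewrite addbb.
Qed.

Lemma sdmulgV (W : groupType) : right_inverse (sdone W) (@sdinv W) (@sdmul W).
Proof.
move=> [x A]; rewrite /sdmul /= mulgV.
by congr pair; apply/funext => t; rewrite conjgK addbb.
Qed.

HB.instance Definition _ (W : groupType) :=
  isGroup.Build (subset_sdprod W)
    (@sdmulA W) (@sdmul1g W) (@sdmulg1 W) (@sdmulVg W) (@sdmulgV W).

Definition sdgen (W : groupType) (s : W) : subset_sdprod W :=
  (s, fun x => x == s).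

Lemma conjg_eq (W : groupType) (x y z : W) : (x ^ y == z) = (x == z ^ y^-1).
Proof. exact: (can2_eq (conjgK y) (conjgKV y)). Qed.

(** Conjugation by [s] inverts the rotation [s * t]; this brings conjugates of [s] by its powers to
    the form [(s * t) ^+ i * s]. *)
Lemma conj_dihedral_expgn (W : groupType) (s t : W) (k : nat) :
  s * s = 1 -> t * t = 1 ->
  (s * ((s * t) ^+ k)^-1 = (s * t) ^+ k * s).
Proof.
move=> ss tt; set c := s * t; apply: (mulIg (c ^+ k)); rewrite mulgVK.
elim: k => [|k IH]; first by rewrite expg0 mul1g mulg1.
suff cc : c * s * c = s by rewrite {1}expgSr expgS mulgA -2!(mulgA (c ^+ k)) cc.
by rewrite /c -mulgA (mulgA s s) ss mul1g -mulgA tt mulg1.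
Qed.

(* The word s t s t ... of length 2k has inversions (s t)^i s for i < 2k,
   counted with multiplicity modulo 2. *)
Lemma sdgen_expgn (W : groupType) (s t : W) (k : nat) :
  s * s = 1 -> t * t = 1 ->
  (sdgen s * sdgen t) ^+ k =
  ((s * t) ^+ k, fun x : W => odd (\sum_(i < k.*2) (x == (s * t) ^+ i * s)%g))
    :> subset_sdprod W.
Proof.
move=> ss tt; elim: k => [|k IH].
  by congr pair; apply/funext => x; rewrite big_ord0.
rewrite expgSr IH expgSr; congr pair; apply/funext => x.
(* The two new letters contribute the conjugates of s and s t s^-1 by (s t)^k: the terms of index 2k
   and 2k+1. *)
rewrite doubleS 2!big_ord_recr /= 2!oddD !oddb -addbA; congr (_ (+) (_ (+) _)).
  rewrite conjg_eq conjgE invgK (conj_dihedral_expgn k ss tt).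
  by rewrite mulgA -expgnDr addnn.
rewrite conjg_eq conjg_eq !conjgE !invgK (mulgA _ t) -(mulgA (s * t)).
rewrite -[s^-1]mulg1 -ss mulKg (conj_dihedral_expgn k ss tt).
by rewrite 2!mulgA -expgSr -expgnDr addSn addnn.
Qed.

Lemma sdgen_coxeter_relations (W : groupType) (S : set W) (m : W -> W -> nat) :
  coxeter_matrix S m -> coxeter_relations S m (fun w : W => w) ->
  coxeter_relations S m (@sdgen W).
Proof.
move=> [m1 _ _] rel s t Ss St.
have sq x : S x -> x * x = 1 by move=> Sx; have := rel x x Sx Sx; rewrite m1.
rewrite sdgen_expgn; [|exact: sq..].
have st1 := rel _ _ Ss St.
rewrite st1; congr pair; apply/funext => x.
(* Since (s t)^m = 1, the inversions of index i and m + i cancel. *)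
rewrite -addnn big_split_ord /= oddD.
under [X in _ (+) odd X]eq_bigr => i _ do rewrite expgnDr st1 mul1g.
by rewrite addbb.
Qed.

(** * Words and the inversion cocycle *)

Definition inversion_cocycle (W : groupType) (S : set W) (N : W -> W -> bool) :
    Prop :=
  [/\ forall x, N 1 x = false,
      forall v w x, N (v * w) x = N v x (+) N w (x ^ v) &
      forall s x, S s -> N s x = (x == s)].

Lemma coxeter_involution {W : groupType} {S : set W} {s : W} :
  coxeter_system S -> S s -> s * s = 1.
Proof.
by move=> [m [[m1 _ _] [_ rel _]]] Ss; have := rel s s Ss Ss; rewrite m1.
Qed.

Lemma inversion_cocycle_exists (W : groupType) (S : set W) :
  coxeter_system S -> exists N : W -> W -> bool, inversion_cocycle S N.
Proof.
move=> [m [mat [gen rel univ]]].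
have [phi [[phi1 phiM] phiS]] := univ _ _ (sdgen_coxeter_relations mat rel).
(* The first component is a morphism fixing S, hence the identity; so the twist in the second
   component is by the element itself. *)
have phi_fst w : (phi w).1 = w.
  suff: w \in [pred x | (phi x).1 == x] by move/eqP.
  apply: gen => [|s Ss]; last by rewrite inE phiS.
  split=> [|x y /eqP xP /eqP yP]; first by rewrite inE phi1.
  suff phiV : phi y^-1 = (phi y)^-1 by rewrite inE phiM phiV /= xP yP.
  by apply: (mulgI (phi y)); rewrite -phiM !mulgV.
exists (fun w => (phi w).2); split=> [x|v w x|s x Ss].
- by rewrite phi1.
- by rewrite phiM /= phi_fst.
- by rewrite phiS.
Qed.

Lemma has_word1 (W : groupType) (S : set W) (s : W) : S s -> has_word S s 1%N.
Proof.
move=> Ss; exists [:: s]; split=> [//|x|]; last by rewrite big_seq1.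
by rewrite inE => /eqP->.
Qed.

Lemma has_wordM (W : groupType) (S : set W) (v w : W) (m n : nat) :
  has_word S v m -> has_word S w n -> has_word S (v * w) (m + n)%N.
Proof.
move=> [k [<- kS ->]] [l [<- lS ->]].
exists (k ++ l); split; [exact: size_cat| |by rewrite big_cat].
by move=> x; rewrite mem_cat => /orP[/kS|/lS].
Qed.

Lemma has_wordV (W : groupType) (S : set W) (w : W) (n : nat) :
  coxeter_system S -> has_word S w n -> has_word S w^-1 n.
Proof.
move=> cox [l [<- lS ->]]; elim: l lS => [|s l IH] lS /=.
  by rewrite big_nil invg1; exists [::]; split=> //; rewrite big_nil.
have Ss : S s by apply: lS; rewrite inE eqxx.
rewrite big_cons invgM (mulg1_eq (coxeter_involution cox Ss)) -addn1.
apply: has_wordM (has_word1 Ss); apply: IH => x xl.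
by apply: lS; rewrite inE xl orbT.
Qed.

Lemma has_word_exists (W : groupType) (S : set W) (w : W) :
  coxeter_system S -> exists n, has_word S w n.
Proof.
move=> cox; have [m [_ [gen _ _]]] := cox.
suff: w \in [pred x | `[< exists n, has_word S x n >]] by move/asboolP.
apply: gen => [|s Ss]; last by apply/asboolP; exists 1%N; apply: has_word1.
split=> [|x y /asboolP[n xn] /asboolP[k yk]]; apply/asboolP.
  by exists 0%N, [::]; split=> //; rewrite big_nil.
by exists (n + k)%N; apply: has_wordM xn (has_wordV cox yk).
Qed.

Lemma cox_lengthP (W : groupType) (S : set W) (w : W) : coxeter_system S ->
  has_word S w (cox_length S w) /\
  forall k, has_word S w k -> (cox_length S w <= k)%N.
Proof.
move=> cox; suff : [set n | has_word S w n /\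
    forall k, has_word S w k -> (n <= k)%N] (cox_length S w) by [].
have [n0 wn0] := has_word_exists w cox.
have ex : exists n, `[< has_word S w n >] by exists n0; apply/asboolP.
case: (ex_minnP ex) => n /asboolP wn n_min.
by apply: (xgetI 0%N (x := n)); split=> // k wk; apply/n_min/asboolP.
Qed.

(* Stated for arbitrary r rather than r in S: the induction passes from r to
   r ^ s. *)
Lemma inversion_exchange (W : groupType) (S : set W) (N : W -> W -> bool)
    (w r : W) (n : nat) :
  coxeter_system S -> inversion_cocycle S N -> has_word S w n -> N w r ->
  exists2 k, k.+1 = n & has_word S (r * w) k.
Proof.
move=> cox [N1 NM NS] [l [<- lS ->]]; elim: l lS r => [|s l IH] lS r.
  by rewrite big_nil N1.
have Ss : S s by apply: lS; rewrite inE eqxx.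
have {}lS x : x \in l -> S x by move=> xl; apply: lS; rewrite inE xl orbT.
(* If r is the first letter, it cancels. Otherwise [r ^ s] is an inversion of the tail, and r s = s
   (r ^ s) moves the deletion there. *)
rewrite big_cons NM NS //; have [-> _|_ /= Nr] := eqVneq r s.
  exists (size l) => //; exists l; split=> //.
  by rewrite mulgA (coxeter_involution cox Ss) mul1g.
have [k <- wk] := IH lS _ Nr; exists k.+1 => //.
by rewrite mulgA (conjgC r) -mulgA; apply: (has_wordM (has_word1 Ss) wk).
Qed.

(** Exchange removes one letter; no more can be lost, since multiplying by r again restores w. *)
Lemma inversion_cox_length (W : groupType) (S : set W) (N : W -> W -> bool)
    (w r : W) :
  coxeter_system S -> inversion_cocycle S N -> S r -> N w r ->
  (cox_length S (r * w)).+1 = cox_length S w.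
Proof.
move=> cox coc Sr Nr.
have [wl w_min] := cox_lengthP w cox.
have [rwl rw_min] := cox_lengthP (r * w) cox.
have [k kl rwk] := inversion_exchange cox coc wl Nr.
apply/eqP; rewrite eqn_leq -{1}kl ltnS rw_min //=; apply: w_min.
have := has_wordM (has_word1 Sr) rwl.
by rewrite mulgA (coxeter_involution cox Sr) mul1g.
Qed.

Lemma recoilE (W : groupType) (S : set W) (N : W -> W -> bool) (w r : W) :
  coxeter_system S -> inversion_cocycle S N -> S r -> recoil S w r <-> N w r.
Proof.
move=> cox coc Sr; split=> [[_ rw_lt]|Nr]; last first.
  by split=> //; apply: inversion_cox_length cox coc Sr Nr.
(* Otherwise r is an inversion of r w, which makes r w longer than w. *)
apply/negPn/negP => Nw; have [_ NM NS] := coc.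
have Nrw : N (r * w) r.
  by rewrite NM NS // eqxx conjgE mulKg (negbTE Nw).
have := inversion_cox_length cox coc Sr Nrw.
rewrite mulgA (coxeter_involution cox Sr) mul1g -rw_lt.
by move/eqP; rewrite eqn_leq ltnNge leqnSn.
Qed.

(** * Simple right multiplications preserving the recoil set *)

Lemma recoil_mulr (W : groupType) (S : set W) (w s : W) :
  coxeter_system S -> S s ->
  recoil S (w * s) = recoil S w <-> ~ S (w * s * w^-1).
Proof.
move=> cox Ss; have [N coc] := inversion_cocycle_exists cox.
have [_ NM NS] := coc.
have NMs r : N (w * s) r = N w r (+) (r == w * s * w^-1).
  by rewrite NM (NS s) // conjg_eq conjgE invgK mulgA.
split=> [eqR Swsw|nS].
  (* w s w^-1 is an inversion of exactly one of w and w s; being simple, it would separate their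
     recoil sets. *)
  have Rws := recoilE (w * s) cox coc Swsw.
  have Rw := recoilE w cox coc Swsw.
  move: Rws; rewrite eqR NMs eqxx addbT; move: Rw.
  by case: (N w _) => -[h1 h2] [h3 h4];
    [have := h3 (h2 isT)|have := h1 (h4 isT)].
apply/seteqP; split=> r rR; have Sr : S r by case: rR.
  all: apply/(recoilE _ cox coc Sr); move/(recoilE _ cox coc Sr): rR;
    rewrite NMs; have [rE|_] := eqVneq r (w * s * w^-1); last by rewrite addbF.
all: by rewrite -rE in nS.
Qed.

Theorem proposition8p4 (W : groupType) (S : set W) (hWS : coxeter_system S)
    (w u v s : W) (hs : S s) (hw : w = u * v)
    (hR : recoil S (w * s) = recoil S w) :
  exists! p : W * W,
    w * s = p.1 * p.2 /\
    ((u = p.1 /\ S (v^-1 * p.2) /\ recoil S v = recoil S p.2) \/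
     (v = p.2 /\ S (u^-1 * p.1) /\ recoil S u = recoil S p.1)).
Proof.
pose t := v * s * v^-1.
have utu : u * t * u^-1 = w * s * w^-1 by rewrite hw invgM /t !mulgA.
have wsv : w * s = u * (v * s) by rewrite hw mulgA.
have wst : w * s = u * t * v by rewrite hw /t !mulgA mulgVK.
have ntw : ~ S (u * t * u^-1) by rewrite utu; apply/recoil_mulr.
(* One factor determines the other, so each of (1) and (2) has a single candidate. *)
have fact1 p : w * s = p.1 * p.2 -> u = p.1 -> p = (u, v * s).
  by case: p => a b /= /[swap] <-; rewrite wsv => /mulgI->.
have fact2 p : w * s = p.1 * p.2 -> v = p.2 -> p = (u * t, v).
  by case: p => a b /= /[swap] <-; rewrite wst => /mulIg->.
(* By [recoil_mulr], (1) forces t to be non-simple; (2) forces u^-1 (u t) = t to be simple, and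
   [ntw] then gives its recoil condition. *)
have [St|nSt] := EM (S t).
  exists (u * t, v); split=> [|p [pE [[uE [_ Rv]]|[vE _]]]].
  - split=> //; right; split=> //=; rewrite mulKg; split=> //.
    by apply/esym/recoil_mulr.
  - rewrite (fact1 p pE uE) /= in Rv.
    by case/recoil_mulr: (esym Rv).
  - by rewrite (fact2 p pE vE).
exists (u, v * s); split=> [|p [pE [[uE _]|[vE [Sp _]]]]].
- split=> //; left; split=> //=; rewrite mulKg; split=> //.
  by apply/esym/recoil_mulr.
- by rewrite (fact1 p pE uE).
- by move: Sp; rewrite (fact2 p pE vE) /= mulKg.
Qed.
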